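(* Let $A$ be a Banach algebra, identified with its canonical image in $A^{**}$. Then: (1) If $\tilde Z_1^\ell(A^{**})=A$, then $A$ is a right ideal in $A^{**}$. (2) If $\tilde Z_1^r(A^{**})=A$, then $A$ is a left ideal in $A^{**}$. (3) If $\tilde Z_1^\ell(A^{**})=\tilde Z_1^r(A^{**})=A$, then $A$ is an ideal in $A^{**}$.
   Context: The second dual $A^{**}$ carries the first Arens product: for $a,b\in A$, $a'\in A^*$, $a'',b''\in A^{**}$, $\langle a'a,b\rangle=\langle a',ab\rangle$, $\langle a''a',a\rangle=\langle a'',a'a\rangle$, $\langle a''b'',a'\rangle=\langle a'',b''a'\rangle$. Definitions: $\tilde Z_1^\ell(A^{**})$ is the set of $a''\in A^{**}$ such that $b''\mapsto a''b''$ is weak*-to-weak continuous on $A^{**}$; $\tilde Z_1^r(A^{**})$ is the set of $a''\in A^{**}$ such that $b''\mapsto b''a''$ is weak*-to-weak continuous on $A^{**}$. Here weak* means $\sigma(A^{**},A^* )$ and weak means $\sigma(A^{**},A^{***})$. *)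

(* Defs.v *)
From HB Require Import structures.
From mathcomp Require Import all_boot all_order all_algebra.
From mathcomp Require Import all_classical all_reals all_analysis.
From mathcomp.real_closed Require Import complex.

Set Implicit Arguments.
Unset Strict Implicit.
Unset Printing Implicit Defensive.

Import Order.TTheory GRing.Theory Num.Theory.
Import numFieldNormedType.Exports.

Local Open Scope classical_set_scope.
Local Open Scope ring_scope.

(* A common interface for the scalar fields R and C: it provides exactly what
   is needed to define the norm of a continuous linear functional, the norm of
   MathComp being valued in the scalar field itself. *)
HB.mixin Record NumField_hasNnegSup K & Num.NumField K := {
  nneg_supremums : forall S : set K, S !=set0 -> (forall x, S x -> 0 <= x) ->
    has_ubound S -> supremums S !=set0
}.

#[short(type="supNumFieldType")]
HB.structure Definition SupNumField :=
  {K of Num.NumField K & NumField_hasNnegSup K}.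

Section ScalarInstances.
Variable R : realType.

Lemma real_nneg_supremums (S : set R) : S !=set0 ->
  (forall x, S x -> 0 <= x) -> has_ubound S -> supremums S !=set0.
Proof.
move=> S0 _ bS; exists (sup S); split; first exact: sup_upper_bound.
by move=> y yub; apply: ge_sup.
Qed.

HB.instance Definition _ := NumField_hasNnegSup.Build R real_nneg_supremums.

Lemma complex_nneg_supremums (S : set R[i]) : S !=set0 ->
  (forall x, S x -> 0 <= x) -> has_ubound S -> supremums S !=set0.
Proof.
move=> S0 Sge0 [M ubM].
pose T : set R := [set complex.Re x | x in S].
have SE x : S x -> x = (complex.Re x)%:C%C.
  by move=> /Sge0; case: x => a b; rewrite lecE /= => /andP[/eqP -> _].
have T0 : T !=set0 by case: S0 => x Sx; exists (complex.Re x); exists x.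
have bT : has_ubound T.
  exists (complex.Re M) => _ [x Sx <-].
  by have := ubM _ Sx; rewrite lecE => /andP[].
exists (sup T)%:C%C; split.
  move=> x Sx; rewrite (SE x Sx) lecR.
  by apply: sup_upper_bound => //; exists x.
move=> y yub; have [x0 Sx0] := S0.
have yim : complex.Im y = 0.
  by have := yub _ Sx0; rewrite {1}(SE _ Sx0) lecE /= => /andP[/eqP].
rewrite lecE /= yim eqxx /=; apply: ge_sup => // _ [x Sx <-].
by have := yub _ Sx; rewrite lecE => /andP[].
Qed.

HB.instance Definition _ := NumField_hasNnegSup.Build R[i] complex_nneg_supremums.

End ScalarInstances.

(* The multiplication is not required to have a unit, hence the algebra
   structures of MathComp, which are unital, are not used. *)
HB.mixin Record CompleteNormedModule_isBanachAlgebra (K : numFieldType) A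
    & CompleteNormedModule K A := {
  bmul : A -> A -> A;
  bmulA : associative bmul;
  bmulDl : left_distributive bmul +%R;
  bmulDr : right_distributive bmul +%R;
  bscalerAl : forall (k : K) (a b : A), k *: bmul a b = bmul (k *: a) b;
  bscalerAr : forall (k : K) (a b : A), k *: bmul a b = bmul a (k *: b);
  ler_norm_bmul : forall a b : A, `|bmul a b| <= `|a| * `|b|
}.

#[short(type="banachAlgType")]
HB.structure Definition BanachAlgebra (K : numFieldType) :=
  {A of CompleteNormedModule K A & CompleteNormedModule_isBanachAlgebra K A}.

Section Dual.
Variables (K : supNumFieldType) (E : normedModType K).

Definition continuous_linear : {pred E -> K^o} :=
  fun f => `[< linear f /\ continuous f >].

Record dual := Dual {
  dual_fun :> E -> K^o;
  dual_funP : dual_fun \in continuous_linear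
}.

HB.instance Definition _ := [isSub for dual_fun].
HB.instance Definition _ := [Choice of dual by <:].

Lemma continuous_linear_submod : submod_closed continuous_linear.
Proof.
split=> [|k f g].
  apply/asboolP; split; last by move=> x; apply: cvg_cst.
  by move=> k x y; rewrite -[LHS]/(0 : K^o) -[RHS]/(k *: (0 : K^o) + 0)
    scaler0 addr0.
move=> /asboolP[fl fc] /asboolP[gl gc]; apply/asboolP; split.
  move=> l x y; rewrite !fctE /= fl gl !scalerDr addrACA !scalerA.
  by rewrite (mulrC k l).
by move=> x; apply: cvgD; [apply: cvgZr; exact: fc|exact: gc].
Qed.

HB.instance Definition _ :=
  GRing.isSubmodClosed.Build K (E -> K^o) continuous_linear
    continuous_linear_submod.
HB.instance Definition _ := [SubChoice_isSubLmodule of dual by <:].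

Lemma dual_linear (f : dual) : linear f.
Proof. by case: f => f /= /asboolP[]. Qed.

Lemma dual_continuous (f : dual) : continuous f.
Proof. by case: f => f /= /asboolP[]. Qed.

HB.instance Definition _ (f : dual) :=
  GRing.isLinear.Build K E K^o *:%R (dual_fun f) (dual_linear f).

Lemma dualP (f g : dual) : f =1 g -> f = g.
Proof. by move=> fg; apply/val_inj/funext. Qed.

(* operator norm: supremum of |f x| over the closed unit ball *)
Definition dual_norm (f : dual) : K :=
  supremum 0 [set `|f x| | x in [set x : E | `|x| <= 1]].

Lemma dual_bounded (f : dual) :
  exists2 M, 0 <= M & forall x, `|f x| <= M * `|x|.
Proof.
have /linear_bounded_continuous/linear_boundedP/pinfty_ex_gt0[M M0 fM] :=
  @dual_continuous f.
by exists M => //; exact: ltW.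
Qed.

Lemma dual_norm_supremums (f : dual) :
  supremums [set `|f x| | x in [set x : E | `|x| <= 1]] (dual_norm f).
Proof.
rewrite /dual_norm /supremum; case: ifPn => [/eqP S0|_].
  have : [set `|f x| | x in [set x : E | `|x| <= 1]] `|f 0|.
    by exists 0 => //=; rewrite normr0 ler01.
  by rewrite S0.
apply: xgetPex; apply: nneg_supremums.
- by exists `|f 0|, 0 => //=; rewrite normr0 ler01.
- by move=> _ [x _ <-].
- have [M M0 fM] := dual_bounded f; exists M => _ [x x1 <-].
  by apply: le_trans (fM x) _; rewrite ler_piMr.
Qed.

Lemma dual_norm_le (f : dual) (M : K) :
  (forall x, `|x| <= 1 -> `|f x| <= M) -> dual_norm f <= M.
Proof.
by move=> fM; apply: (dual_norm_supremums f).2 => _ [x x1 <-]; exact: fM.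
Qed.

Lemma dual_norm_ge0 (f : dual) : 0 <= dual_norm f.
Proof.
apply: le_trans (normr_ge0 (f 0)) _; apply: (dual_norm_supremums f).1.
by exists 0 => //=; rewrite normr0 ler01.
Qed.

Lemma ler_dual_norm (f : dual) x : `|f x| <= dual_norm f * `|x|.
Proof.
have [->|x0] := eqVneq x 0; first by rewrite linear0 !normr0 mulr0.
have nx0 : 0 < `|x| by rewrite normr_gt0.
rewrite -ler_pdivrMr//.
have -> : `|f x| / `|x| = `|f (`|x|^-1 *: x)|.
  by rewrite linearZ /= normrZ ger0_norm ?invr_ge0// mulrC.
apply: (dual_norm_supremums f).1; exists (`|x|^-1 *: x) => //=.
by rewrite normrZ ger0_norm ?invr_ge0// mulVf// gt_eqF.
Qed.

Lemma dual_normD (f g : dual) : dual_norm (f + g) <= dual_norm f + dual_norm g.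
Proof.
apply: dual_norm_le => x x1; apply: le_trans (ler_normD (f x) (g x)) _.
by apply: lerD; (apply: le_trans (ler_dual_norm _ _) _;
  rewrite ler_piMr// dual_norm_ge0).
Qed.

Lemma dual_normZ_le (k : K) (f : dual) :
  dual_norm (k *: f) <= `|k| * dual_norm f.
Proof.
apply: dual_norm_le => x x1.
rewrite -[X in `|X| <= _]/(k * f x) normrM ler_wpM2l//.
by apply: le_trans (ler_dual_norm _ _) _; rewrite ler_piMr// dual_norm_ge0.
Qed.

Lemma dual_normZ (k : K) (f : dual) : dual_norm (k *: f) = `|k| * dual_norm f.
Proof.
apply/le_anti; rewrite dual_normZ_le /=.
have [->|k0] := eqVneq k 0; first by rewrite normr0 mul0r dual_norm_ge0.
rewrite -ler_pdivlMl ?normr_gt0// -normfV.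
by rewrite -{1}[f](scalerK k0) dual_normZ_le.
Qed.

Lemma dual_norm0_eq0 (f : dual) : dual_norm f = 0 -> f = 0.
Proof.
move=> f0; apply: dualP => x; apply/eqP; rewrite -normr_le0.
by apply: le_trans (ler_dual_norm f x) _; rewrite f0 mul0r.
Qed.

HB.instance Definition _ := Lmodule_isNormed.Build K dual
  dual_normD dual_normZ dual_norm0_eq0.

Lemma bounded_dual_funP (f : E -> K^o) (M : K) : linear f -> 0 <= M ->
  (forall x, `|f x| <= M * `|x|) -> f \in continuous_linear.
Proof.
move=> fl M0 fM; apply/asboolP; split=> //.
pose lf : {linear E -> K^o} := HB.pack f (GRing.isLinear.Build _ _ _ _ f fl).
apply: (@bounded_linear_continuous _ _ _ lf); apply/linear_boundedP.
near=> r => x; apply: le_trans (fM x) _; apply: ler_wpM2r => //.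
near: r; apply: nbhs_pinfty_ge; exact: ger0_real.
Unshelve. all: by end_near. Qed.

End Dual.

Section WeakTopologies.
Variables (K : supNumFieldType) (E : normedModType K).

(* sigma(E, E^* ): the coarsest topology on E making every element of the dual
   of E continuous *)
Definition weak : topologicalType :=
  sup_topology (fun f : dual E => Topological.on (initial_topology f)).

(* sigma(E^*, E): the coarsest topology on the dual of E making the evaluation
   at every point of E continuous *)
Definition weak_star : topologicalType :=
  sup_topology (fun x : E => Topological.on
    (initial_topology (fun f : dual E => f x : K^o))).

Lemma canon_dual (x : E) :
  (fun f : dual E => f x : K^o) \in @continuous_linear K (dual E).
Proof.
apply: (@bounded_dual_funP _ _ _ `|x|) => // f.
by rewrite mulrC; exact: ler_dual_norm.
Qed.

Definition canon (x : E) : dual (dual E) := Dual (canon_dual x).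

Definition canon_image : set (dual (dual E)) := range canon.

End WeakTopologies.

Arguments canon_image {K} E.

Section Arens.
Variables (K : supNumFieldType) (A : banachAlgType K).

Lemma dual_act_dual (f : dual A) (a : A) :
  (fun b => f (bmul a b)) \in @continuous_linear K A.
Proof.
apply: (@bounded_dual_funP _ _ _ (dual_norm f * `|a|)).
- by move=> k x y /=; rewrite bmulDr -bscalerAr linearP.
- by rewrite mulr_ge0 ?dual_norm_ge0.
- move=> x; apply: le_trans (ler_dual_norm _ _) _.
  by rewrite -mulrA ler_wpM2l ?dual_norm_ge0 ?ler_norm_bmul.
Qed.

(* <a' a, b> = <a', a b> *)
Definition dual_act (f : dual A) (a : A) : dual A := Dual (dual_act_dual f a).

Lemma bidual_act_dual (F : dual (dual A)) (f : dual A) :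
  (fun a => F (dual_act f a)) \in @continuous_linear K A.
Proof.
apply: (@bounded_dual_funP _ _ _ (dual_norm F * dual_norm f)).
- move=> k x y /=; rewrite -linearP; congr (F _); apply: dualP => b.
  rewrite -[RHS]/(k * f (bmul x b) + f (bmul y b)) /=.
  by rewrite bmulDl -bscalerAl linearP.
- by rewrite mulr_ge0 ?dual_norm_ge0.
- move=> x; apply: le_trans (ler_dual_norm _ _) _.
  rewrite -mulrA ler_wpM2l ?dual_norm_ge0//; apply: dual_norm_le => b b1 /=.
  apply: le_trans (ler_dual_norm _ _) _; rewrite ler_wpM2l ?dual_norm_ge0//.
  by apply: le_trans (ler_norm_bmul _ _) _; rewrite ler_piMr.
Qed.

(* <a'' a', a> = <a'', a' a> *)
Definition bidual_act (F : dual (dual A)) (f : dual A) : dual A :=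
  Dual (bidual_act_dual F f).

Lemma arens_dual (F G : dual (dual A)) :
  (fun f => F (bidual_act G f)) \in @continuous_linear K (dual A).
Proof.
apply: (@bounded_dual_funP _ _ _ (dual_norm F * dual_norm G)).
- move=> k f g /=; rewrite -linearP; congr (F _); apply: dualP => a.
  rewrite -[RHS]/(k *: G (dual_act f a) + G (dual_act g a)) -linearP /=.
  by congr (G _); apply: dualP.
- by rewrite mulr_ge0 ?dual_norm_ge0.
- move=> f; apply: le_trans (ler_dual_norm _ _) _.
  rewrite -mulrA ler_wpM2l ?dual_norm_ge0//; apply: dual_norm_le => a a1 /=.
  apply: le_trans (ler_dual_norm _ _) _; rewrite ler_wpM2l ?dual_norm_ge0//.
  apply: dual_norm_le => b b1 /=; apply: le_trans (ler_dual_norm _ _) _.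
  rewrite ler_piMr ?dual_norm_ge0//; apply: le_trans (ler_norm_bmul _ _) _.
  by rewrite mulr_ile1.
Qed.

(* first Arens product: <a'' b'', a'> = <a'', b'' a'> *)
Definition arens (F G : dual (dual A)) : dual (dual A) := Dual (arens_dual F G).

Definition Z1l : set (dual (dual A)) :=
  [set F | continuous (arens F : weak_star (dual A) -> weak (dual (dual A)))].

Definition Z1r : set (dual (dual A)) :=
  [set F | continuous
    (arens^~ F : weak_star (dual A) -> weak (dual (dual A)))].

Definition right_ideal (I : set (dual (dual A))) :=
  submod_closed [in I] /\ forall F G, I F -> I (arens F G).

Definition left_ideal (I : set (dual (dual A))) :=
  submod_closed [in I] /\ forall F G, I G -> I (arens F G).

Definition ideal (I : set (dual (dual A))) := left_ideal I /\ right_ideal I.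

End Arens.

Arguments Z1l {K} A.
Arguments Z1r {K} A.

(* Main.v *)
Require Import Defs.
From HB Require Import structures.
From mathcomp Require Import all_boot all_order all_algebra.
From mathcomp Require Import all_classical all_reals all_analysis.
From mathcomp Require Import ring lra.
From mathcomp.real_closed Require Import complex.

Set Implicit Arguments.
Unset Strict Implicit.
Unset Printing Implicit Defensive.

Import Order.TTheory GRing.Theory Num.Theory.
Import numFieldNormedType.Exports.

Local Open Scope classical_set_scope.
Local Open Scope ring_scope.

(** Write [E] for a Banach space, identified with its image in its bidual.  The
    ideal property is one half of Gantmacher's theorem on weakly compact
    operators: a map [T] of the bidual that is weak*-to-weak continuous and sends
    [E] into [E] sends the whole bidual into [E] ([weak_star_weak_range]).  It is
    applied to left or right Arens multiplication by an element [a] of the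
    algebra; this is weak*-to-weak continuous because [a] belongs to the left or
    right center, and it sends [canon b] to [canon (a b)] or [canon (b a)].

    The range theorem is proved by duality.  If [T G] were not in [E], then,
    [E] being complete and hence norm closed in its bidual
    ([canon_image_closed]), a continuous functional [Phi] on the bidual would
    vanish on [E] and not at [T G].  Now [Phi \o T] is weak*-continuous and
    vanishes on [E], which is weak*-dense in the bidual
    ([weak_star_continuous_eq0]); so it vanishes at [G], a contradiction.
    Weak* density amounts to interpolation on finitely many functionals, which
    is linear algebra ([canon_interpolation]).

    Hahn-Banach separation enters twice, to find [Phi] and to show that [canon]
    is isometric.  Both uses are covered by the property [norm_separation] of
    the scalar field.  For real scalars it follows from the Mazur-Orlicz theorem
    ([Mazur_Orlicz]), obtained here from Zorn's lemma applied to sublinear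
    functionals, without any extension of partially defined functionals; for
    complex scalars it follows from the real case through the functional
    [x |-> f x - i f (i x)]. *)

Local Notation canon := Defs.canon.

(** * Sublinear functionals and the Mazur-Orlicz theorem *)

Section MazurOrlicz.
Variables (R : realType) (V : lmodType R).
Implicit Types (p q : V -> R) (C : set (V * R)) (x y : V) (t : R).

(** The inequality in the second clause is in fact an equality, see
    [sublinearZ]; the inequality is the easier condition to check on infima. *)
Definition sublinear q :=
  (forall x y, q (x + y) <= q x + q y) /\
  (forall t x, 0 <= t -> q (t *: x) <= t * q x).

Lemma sublinear0 q : sublinear q -> q 0 = 0.
Proof.
move=> [qD qZ]; apply/le_anti/andP; split.
  by have := qZ 0 0 (lexx 0); rewrite scale0r mul0r.
by have := qD 0 0; rewrite addr0 lerDl.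
Qed.

Lemma sublinearZ q t x : sublinear q -> 0 <= t -> q (t *: x) = t * q x.
Proof.
move=> sq; rewrite le_eqVlt => /predU1P[<-|t0].
  by rewrite scale0r mul0r sublinear0.
apply/le_anti; rewrite (sq.2 _ _ (ltW t0)) /= -ler_pdivlMl//.
have tV0 : 0 <= t^-1 by rewrite invr_ge0 ltW.
have := sq.2 _ (t *: x) tV0.
by rewrite scalerA mulVf ?gt_eqF// scale1r.
Qed.

Lemma sublinearN q x : sublinear q -> - q (- x) <= q x.
Proof.
by move=> sq; rewrite lerNl -subr_ge0 opprK addrC -(sublinear0 sq) -(subrr x) sq.1.
Qed.

(** The cone collects the constraints [c.2 <= f c.1] that a linear functional
    [f] below [p] should satisfy. *)
Definition dominated_cone p C := [/\ C (0, 0),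
  (forall c d, C c -> C d -> C (c.1 + d.1, c.2 + d.2)),
  (forall t c, 0 <= t -> C c -> C (t *: c.1, t * c.2)) &
  (forall c, C c -> c.2 <= p c.1)].

(** This is the largest sublinear functional [q] below [p] for which
    [q (- c.1) <= - c.2] for all [c] in the cone, so that every linear functional
    below [q] satisfies the constraints of the cone. *)
Definition cone_inf p C x := inf [set p (x + c.1) - c.2 | c in C].

Section ConeInf.
Variables (p : V -> R) (C : set (V * R)).
Hypotheses (sp : sublinear p) (dC : dominated_cone p C).

Lemma cone_inf_le x c : C c -> cone_inf p C x <= p (x + c.1) - c.2.
Proof.
move=> Cc; apply: ge_inf; last by exists c.
exists (- p (- x)) => _ [d Cd <-]; have [_ _ _ Cp] := dC.
have := sp.1 (- x) (x + d.1); rewrite addKr => pD.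
by have := Cp d Cd; lra.
Qed.

Lemma ge_cone_inf m x :
  (forall c, C c -> m <= p (x + c.1) - c.2) -> m <= cone_inf p C x.
Proof.
move=> mle; apply: lb_le_inf; last by move=> _ [c Cc <-]; exact: mle.
by have [C0 _ _ _] := dC; exists (p (x + 0) - 0), (0, 0).
Qed.

Lemma cone_inf_le_self x : cone_inf p C x <= p x.
Proof.
by have [C0 _ _ _] := dC; have := cone_inf_le x C0; rewrite /= addr0 subr0.
Qed.

Lemma cone_inf_sublinear : sublinear (cone_inf p C).
Proof.
have [C0 CD CZ _] := dC; split=> [x y|t x].
  rewrite -lerBlDr; apply: ge_cone_inf => c Cc; rewrite lerBlDl -lerBlDr.
  apply: ge_cone_inf => d Cd.
  have := cone_inf_le (x + y) (CD _ _ Cc Cd); rewrite /= addrACA.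
  by have := sp.1 (x + c.1) (y + d.1); lra.
rewrite le_eqVlt => /predU1P[<-|t0].
  have := cone_inf_le_self 0.
  by rewrite scale0r mul0r (sublinear0 sp).
rewrite -(ler_pdivrMl _ _ t0); apply: ge_cone_inf => c Cc; rewrite ler_pdivrMl//.
apply: le_trans (cone_inf_le (t *: x) (CZ _ _ (ltW t0) Cc)) _ => /=.
by rewrite -scalerDr (sublinearZ _ sp (ltW t0)) mulrBr.
Qed.

End ConeInf.

Definition minimal_sublinear q := sublinear q /\
  forall q', sublinear q' -> (forall x, q' x <= q x) -> forall x, q x <= q' x.

(** In a chain, two members can be replaced by the smaller one, which makes the
    pointwise infimum subadditive; it is finite because every [q <= p] satisfies
    [- p (- x) <= q x]. *)
Lemma chain_inf_sublinear p (S : set (V -> R)) : S !=set0 ->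
  (forall q, S q -> sublinear q /\ forall x, q x <= p x) ->
  (forall q q', S q -> S q' ->
    (forall x, q x <= q' x) \/ (forall x, q' x <= q x)) ->
  exists2 q0, sublinear q0 & forall q, S q -> forall x, q0 x <= q x.
Proof.
move=> [q1 Sq1] Ssub Stot.
pose q0 x := inf [set q x | q in S].
have q0_le q x : S q -> q0 x <= q x.
  move=> Sq; apply: ge_inf; last by exists q.
  exists (- p (- x)) => _ [q' /Ssub[sq' q'p] <-].
  by have := sublinearN x sq'; have := q'p (- x); lra.
have ge_q0 m x : (forall q, S q -> m <= q x) -> m <= q0 x.
  move=> mle; apply: lb_le_inf; first by exists (q1 x), q1.
  by move=> _ [q Sq <-]; exact: mle.
exists q0; last by move=> q Sq x; exact: q0_le.
split=> [x y|t x].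
  rewrite -lerBlDr; apply: (ge_q0) => q Sq; rewrite lerBlDl -lerBlDr.
  apply: (ge_q0) => q' Sq'; rewrite lerBlDr.
  have [qD _] := (Ssub q Sq).1; have [q'D _] := (Ssub q' Sq').1.
  have [qq'|q'q] := Stot q q' Sq Sq'.
    by apply: le_trans (q0_le q _ Sq) _; have := qD x y; have := qq' y; lra.
  by apply: le_trans (q0_le q' _ Sq') _; have := q'D x y; have := q'q x; lra.
rewrite le_eqVlt => /predU1P[<-|t0].
  rewrite scale0r mul0r -(sublinear0 (Ssub q1 Sq1).1); exact: q0_le.
rewrite -(ler_pdivrMl _ _ t0); apply: (ge_q0) => q Sq; rewrite ler_pdivrMl//.
by rewrite -(sublinearZ x (Ssub q Sq).1 (ltW t0)); exact: q0_le.
Qed.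

Lemma exists_minimal_sublinear p : sublinear p ->
  exists2 q, minimal_sublinear q & forall x, q x <= p x.
Proof.
move=> sp.
pose T := {q : V -> R | sublinear q /\ forall x, q x <= p x}.
have Tp : sublinear p /\ forall x, p x <= p x by split.
pose below (q q' : T) := `[< forall x, sval q' x <= sval q x >].
have [|q q' q''| |[q [sq qp]] qmin] := @ZL_preorder T (exist _ p Tp) below.
- by move=> q; apply/asboolP.
- move=> /asboolP h /asboolP h'; apply/asboolP => x.
  exact: le_trans (h' x) (h x).
- move=> A Atot.
  have [[q1 Aq1]|A0] := pselect (A !=set0); last first.
    by exists (exist _ p Tp) => q Aq; case: A0; exists q.
  have [|_ [q' _ <-]|_ _ [q Aq <-] [q' Aq' <-]|q0 sq0 q0le] :=
    @chain_inf_sublinear p [set sval q | q in A].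
  + by exists (sval q1), q1.
  + exact: (svalP q').
  + by have [/asboolP|/asboolP] := Atot q q' Aq Aq'; [right|left].
  have Tq0 : sublinear q0 /\ forall x, q0 x <= p x.
    split=> // x; apply: le_trans (q0le (sval q1) _ x) ((svalP q1).2 x).
    by exists q1.
  exists (exist _ q0 Tq0) => q Aq; apply/asboolP => x /=.
  by apply: q0le; exists q.
exists q => //; split=> // q' sq' q'q x.
have Tq' : sublinear q' /\ forall x, q' x <= p x.
  by split=> // z; exact: le_trans (q'q z) (qp z).
have /asboolP := qmin (exist _ q' Tq') (introT (asboolP _) q'q).
exact.
Qed.

(** The cone spanned by [(y, q y)] is dominated by [q], and [cone_inf] then
    gives a sublinear functional below [q].  By minimality it is [q] itself,
    whence [q x <= q (x + y) - q y], the missing half of additivity. *)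
Lemma minimal_sublinear_scalar q : minimal_sublinear q -> scalar q.
Proof.
move=> [sq qmin].
have qge x y : q x + q y <= q (x + y).
  pose C := [set (t *: y, t * q y) | t in [set t : R | 0 <= t]].
  have dC : dominated_cone q C.
    split.
    - by exists 0; rewrite /= ?scale0r ?mul0r.
    - move=> _ _ [t /= t0 <-] [u /= u0 <-]; exists (t + u) => /=.
        exact: addr_ge0.
      by rewrite scalerDl mulrDl.
    - move=> t _ t0 [u /= u0 <-]; exists (t * u) => /=; first exact: mulr_ge0.
      by rewrite scalerA mulrA.
    - by move=> _ [t /= t0 <-] /=; rewrite sublinearZ.
  have Cy : C (y, q y) by exists 1; rewrite /= ?scale1r ?mul1r.
  have := qmin _ (cone_inf_sublinear sq dC) (cone_inf_le_self sq dC) x.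
  by have := cone_inf_le sq dC x Cy; rewrite /=; lra.
have qD x y : q (x + y) = q x + q y by apply/le_anti; rewrite qge sq.1.
have qN x : q (- x) = - q x.
  by apply/eqP; rewrite -addr_eq0 -qD addNr sublinear0.
move=> t x y; rewrite qD; congr (_ + _).
have [t0|t0] := leP 0 t; first by rewrite sublinearZ.
rewrite -[t]opprK scaleNr qN sublinearZ ?oppr_ge0 ?ltW//.
by rewrite -mulNr.
Qed.

(** A minimal sublinear functional below [cone_inf p C] is linear, and its value
    at [- c.1] is at most [- c.2]. *)
Theorem Mazur_Orlicz p C : sublinear p -> dominated_cone p C ->
  exists f, [/\ scalar f, (forall x, f x <= p x) &
                forall c, C c -> c.2 <= f c.1].
Proof.
move=> sp dC.
have [q mq qle] := exists_minimal_sublinear (cone_inf_sublinear sp dC).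
have ql := minimal_sublinear_scalar mq; exists q; split=> //.
  by move=> x; exact: le_trans (qle x) (cone_inf_le_self sp dC x).
move=> c Cc.
pose lq : {scalar V} := HB.pack q (GRing.isLinear.Build _ _ _ _ q ql).
have := le_trans (qle (- c.1)) (cone_inf_le sp dC _ Cc).
rewrite addNr sublinear0// -[q _]/(lq _) linearN /=; lra.
Qed.

End MazurOrlicz.

(** * Weak topologies, and weak* density of a space in its bidual *)

Section WeakStarDensity.
Variables (K : supNumFieldType) (E : normedModType K).
Implicit Types (f g : dual E) (s : seq (dual E)) (F G : dual (dual E)).

Lemma canon_linear : linear (@canon K E).
Proof. by move=> k x y; apply: dualP => f; exact: linearP. Qed.

HB.instance Definition _ :=
  GRing.isLinear.Build K E (dual (dual E)) *:%R (@canon K E) canon_linear.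

(** A functional vanishing on the common kernel of finitely many functionals is
    a linear combination of them.  Testing against all [G] in the bidual expresses
    this without naming the coefficients. *)
Lemma common_kernel s f G :
  (forall x, (forall g, g \in s -> g x = 0) -> f x = 0) ->
  (forall g, g \in s -> G g = 0) -> G f = 0.
Proof.
elim: s f => [|g s IHs] f kerf Gs.
  suff -> : f = 0 by exact: linear0.
  by apply: dualP => x; exact: kerf.
have Gg : G g = 0 by apply: Gs; exact: mem_head.
have {}Gs h : h \in s -> G h = 0 by move=> hs; apply: Gs; rewrite inE hs orbT.
have [[c sc gc]|gker] :=
    pselect (exists2 c, forall h, h \in s -> h c = 0 & g c != 0); last first.
  apply: IHs => // x sx; apply: kerf => h; rewrite inE => /predU1P[->|]; last exact: sx.
  by apply: contrapT => /eqP gx; case: gker; exists x.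
(* Subtracting this multiple of [g] makes [f] vanish at [c], hence on the
   common kernel of [s], spanned by [c] and the common kernel of [g :: s]. *)
suff : G (f - (f c / g c) *: g) = 0.
  by rewrite linearB linearZ /= Gg scaler0 subr0.
apply: IHs => // x sx.
have -> : (f - (f c / g c) *: g) x = f (x - (g x / g c) *: c).
  have -> : f (x - (g x / g c) *: c) = f x - g x / g c * f c.
    by rewrite linearB linearZ.
  rewrite -[LHS]/(f x - (f c / g c) * g x).
  by rewrite mulrAC (mulrC (f c)) mulrAC.
apply: kerf => h; rewrite linearB linearZ /= inE => /predU1P[->|hs].
  by rewrite -[_ *: _]/(g x / g c * g c) divfK// subrr.
by rewrite (sx h hs) (sc h hs) scaler0 subr0.
Qed.

(** By [common_kernel], either the constraint at a new functional [f] can be met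
    by moving along a vector on which the previous functionals vanish and [f] does
    not, or it already follows from the previous ones. *)
Lemma canon_interpolation s G : exists x, forall g, g \in s -> g x = G g.
Proof.
elim: s => [|f s [x sx]]; first by exists 0.
have [[c sc fc]|fker] :=
    pselect (exists2 c, forall g, g \in s -> g c = 0 & f c != 0).
  exists (x + ((G f - f x) / f c) *: c) => g; rewrite linearD linearZ /= inE.
  move=> /predU1P[->|gs]; last by rewrite (sx g gs) (sc g gs) scaler0 addr0.
  by rewrite -[_ *: _]/((G f - f x) / f c * f c) divfK// addrC subrK.
exists x => g; rewrite inE => /predU1P[->|]; last exact: sx.
apply/esym/eqP; rewrite -subr_eq0; apply/eqP.
have /= := @common_kernel s f (G - canon x); apply.
  move=> y sy; apply: contrapT => /eqP fy; case: fker; by exists y.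
by move=> h hs; rewrite -[LHS]/(G h - h x) (sx h hs) subrr.
Qed.

(** A filter on the canonical image that converges weak* to [G], because its
    elements eventually agree with [G] at each functional. *)
Definition canon_filter G : set_system (dual (dual E)) :=
  filter_from setT
    (fun s => [set canon x | x in [set x | forall g, g \in s -> g x = G g]]).

Lemma canon_filter_proper G : ProperFilter (canon_filter G).
Proof.
apply: filter_from_proper; last first.
  by move=> s _; have [x sx] := canon_interpolation s G; exists (canon x), x.
apply: filter_from_filter; first by exists [::].
move=> s t _ _; exists (s ++ t) => // _ [x stx <-].
by split; exists x => //= g gs; apply: stx; rewrite mem_cat gs ?orbT.
Qed.

Lemma canon_filter_cvg G : canon_filter G --> (G : weak_star (dual E)).
Proof.
have FF := canon_filter_proper G; apply/cvg_sup => f A [B [[C oC <-] CG BA]].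
exists [:: f] => // _ [x fx <-]; apply: BA => /=.
by rewrite fx ?mem_head.
Qed.

Lemma weak_star_continuous_eq0 (psi : dual (dual E) -> K^o) :
  continuous (psi : weak_star (dual E) -> K^o) ->
  (forall x, psi (canon x) = 0) -> forall G, psi G = 0.
Proof.
move=> psic psi0 G; have FF := canon_filter_proper G.
have psiG : psi @ canon_filter G --> psi G.
  exact: cvg_trans (cvg_app psi (@canon_filter_cvg G)) (psic G).
apply: (cvg_unique (@norm_hausdorff _ _) psiG).
apply: cvg_near_cst; exists [::] => // _ [x _ <-]; exact: psi0.
Qed.

End WeakStarDensity.

Lemma weak_functional_continuous (K : supNumFieldType) (E : normedModType K)
  (f : dual E) : continuous (f : weak E -> K^o).
Proof.
move=> x; have FF : Filter (nbhs (x : weak E)) by apply: nbhs_filter.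
have /cvg_sup/(_ f) fx : nbhs (x : weak E) --> (x : weak E) by [].
exact: cvg_trans (cvg_app f fx) (@initial_continuous _ _ f x).
Qed.

(** * Hahn-Banach separation over the real and complex numbers *)

(** The Hahn-Banach theorem in the form used here.  Taking for [S] the null space
    and [d] the norm of [x] gives norming functionals; taking for [S] a closed
    subspace gives separation of [x] from it. *)
Definition norm_separation (K : supNumFieldType) :=
  forall (E : normedModType K) (S : set E) (x : E) (d : K),
  submod_closed [in S] -> 0 <= d -> (forall s, S s -> d <= `|x - s|) ->
  exists f : dual E, [/\ forall s, S s -> f s = 0,
    forall y, `|f y| <= `|y| & d <= `|f x|].

(** The constraints [f >= 0] on [S] and [f x >= d] are gathered in the cone of the
    pairs [(s + t *: x, t * d)] with [t >= 0]; on the subspace [S], [f >= 0] forces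
    [f = 0]. *)
Lemma sublinear_separation (R : realType) (V : lmodType R) (p : V -> R)
    (S : set V) (x : V) (d : R) :
  sublinear p -> (forall y, 0 <= p y) -> submod_closed [in S] ->
  (forall s, S s -> d <= p (x - s)) ->
  exists f, [/\ scalar f, forall y, f y <= p y, forall s, S s -> f s = 0 &
    d <= f x].
Proof.
move=> sp p0 [S0 Slin] xS.
have {}S0 : S 0 by rewrite inE in S0.
have {}Slin t y z : S y -> S z -> S (t *: y + z).
  by move=> Sy Sz; have := Slin t y z; rewrite !inE; apply.
have SZ t y : S y -> S (t *: y) by move=> /(Slin t _ 0); rewrite addr0; exact.
pose C := [set c : V * R |
  exists2 s, S s & exists2 t, 0 <= t & c = (s + t *: x, t * d)].
have dC : dominated_cone p C.
  split.
  - by exists 0 => //; exists 0 => //; rewrite scale0r mul0r addr0.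
  - move=> _ _ [s Ss [t t0 ->]] [s' Ss' [t' t'0 ->]]; exists (s + s').
      by rewrite -[s]scale1r; exact: Slin.
    exists (t + t'); first exact: addr_ge0.
    by rewrite addrACA -scalerDl -mulrDl.
  - move=> k _ k0 [s Ss [t t0 ->]]; exists (k *: s); first exact: SZ.
    exists (k * t); first exact: mulr_ge0.
    by rewrite /= scalerDr scalerA mulrA.
  - move=> _ [s Ss [t t0 ->]] /=.
    move: t0; rewrite le_eqVlt => /predU1P[<-|t0]; first by rewrite mul0r.
    have -> : s + t *: x = t *: (x - (- t^-1) *: s).
      by rewrite scaleNr opprK scalerDr scalerA divff ?gt_eqF// scale1r addrC.
    rewrite (sublinearZ _ sp (ltW t0)) ler_pM2l//.
    exact/xS/SZ.
have [f [fl fp fC]] := Mazur_Orlicz sp dC; exists f; split=> // [s Ss|].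
  pose lf : {scalar V} := HB.pack f (GRing.isLinear.Build _ _ _ _ f fl).
  have fge0 y : S y -> 0 <= f y.
    move=> Sy; suff /fC : C (y, 0) by [].
    by exists y => //; exists 0 => //; rewrite scale0r addr0 mul0r.
  apply/le_anti; rewrite fge0// andbT -oppr_ge0 -[f s]/(lf s) -linearN.
  by apply: fge0; rewrite -scaleN1r; exact: SZ.
suff /fC : C (x, d) by [].
by exists 0 => //; exists 1 => //; rewrite scale1r add0r mul1r.
Qed.

Lemma real_norm_separation (R : realType) : norm_separation R.
Proof.
move=> E S x d Ssub d0 xS.
have snorm : sublinear (fun y : E => `|y| : R).
  split=> [y z|t y t0] /=; first exact: ler_normD.
  by rewrite normrZ ger0_norm.
have [//|f [fl fle fS fx]] := sublinear_separation snorm _ Ssub xS.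
pose lf : {scalar E} := HB.pack f (GRing.isLinear.Build _ _ _ _ f fl).
have fnorm y : `|f y| <= `|y|.
  rewrite ler_norml fle lerNl -[f y]/(lf y) -linearN.
  by rewrite -normrN andbT; exact: fle.
have fdual : (f : E -> R^o) \in @continuous_linear R E.
  by apply: (@bounded_dual_funP _ _ _ 1) => // y; rewrite mul1r.
exists (Dual fdual); split=> //=.
by apply: le_trans fx _; exact: ler_norm.
Qed.

(** An alias that carries the structure of real vector space obtained by
    restriction of scalars. *)
Definition realification (R : realType) (V : lmodType R[i]) : Type := V.

Section Realification.
Variables (R : realType) (V : lmodType R[i]).
Local Notation VR := (realification V).

HB.instance Definition _ := GRing.Zmodule.on VR.

Definition real_scale (t : R) (x : VR) : VR := (t%:C%C : R[i]) *: (x : V).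

Lemma real_scaleA s t x : real_scale s (real_scale t x) = real_scale (s * t) x.
Proof. by rewrite /real_scale scalerA rmorphM. Qed.

Lemma real_scale1 : left_id 1 real_scale.
Proof. by move=> x; rewrite /real_scale scale1r. Qed.

Lemma real_scaleDr : right_distributive real_scale +%R.
Proof. by move=> t x y; exact: scalerDr. Qed.

Lemma real_scaleDl x : {morph real_scale^~ x : s t / s + t}.
Proof. by move=> s t; rewrite /real_scale rmorphD scalerDl. Qed.

HB.instance Definition _ := GRing.Zmodule_isLmodule.Build R VR
  real_scaleA real_scale1 real_scaleDr real_scaleDl.

(** The complex-linear functional [x |-> f x - i f (i x)], whose real part is
    [f]. *)
Definition complexify (f : VR -> R) (x : V) : R[i] :=
  (f x +i* - f ('i%C *: x : V))%C.

Lemma complexify_linear (f : VR -> R) :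
  scalar f -> linear (complexify f : V -> R[i]^o).
Proof.
move=> fl.
pose lf : {scalar VR} := HB.pack f (GRing.isLinear.Build _ _ _ _ f fl).
have fD (y z : V) : f (y + z) = f y + f z := linearD lf y z.
have fZ (t : R) (y : V) : f (t%:C%C *: y : V) = t * f y := linearZ_LR lf t y.
move=> [a b] x y.
have -> : complexify f ((a +i* b)%C *: x + y) =
    complexify f ((a +i* b)%C *: x) + complexify f y.
  by rewrite /complexify scalerDr !fD opprD.
congr (_ + _); rewrite -[RHS]/((a +i* b)%C * complexify f x) /complexify.
have -> : (a +i* b)%C *: x = a%:C%C *: x + b%:C%C *: ('i%C *: x).
  rewrite scalerA -scalerDl; congr (_ *: _).
  by apply/eqP; rewrite eq_complex /=; apply/andP; split; apply/eqP; ring.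
have -> : 'i%C *: (a%:C%C *: x + b%:C%C *: ('i%C *: x)) =
    a%:C%C *: ('i%C *: x) + (- b)%:C%C *: x.
  rewrite scalerDr !scalerA; congr (_ *: _ + _ *: _);
  by apply/eqP; rewrite eq_complex /=; apply/andP; split; apply/eqP; ring.
rewrite !fD !fZ.
by apply/eqP; rewrite eq_complex /=; apply/andP; split; apply/eqP; ring.
Qed.

End Realification.

Lemma complex_ge0E (R : realType) (z : R[i]) : 0 <= z -> z = (complex.Re z)%:C%C.
Proof. by case: z => a b; rewrite lecE /= => /andP[/eqP -> _]. Qed.

(** The real-linear functional [f] given by [sublinear_separation] is the real
    part of [g := complexify f].  To bound [g y], it is rotated by a scalar of
    modulus one into a nonnegative number, where [g] and [f] agree; and [g]
    vanishes on [S] because [S] is stable under multiplication by [i]. *)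
Lemma complex_norm_separation (R : realType) : norm_separation R[i].
Proof.
move=> E S x d [S0 Slin] d0 xS.
pose p (y : realification E) : R := complex.Re (`|y : E| : R[i]).
have pE (y : E) : `|y| = (p y)%:C%C by apply/complex_ge0E.
have sp : sublinear p.
  split=> [y z|t y t0].
    by rewrite -lecR rmorphD /= -!pE; exact: (ler_normD (y : E) (z : E)).
  rewrite -lecR rmorphM /= -!pE -[t *: y]/(t%:C%C *: (y : E)) normrZ.
  by rewrite ger0_norm// ler0c.
have p0 y : 0 <= p y by rewrite -lecR -pE; exact: normr_ge0.
have SsubR : submod_closed [in (S : set (realification E))].
  by split=> // t y z; exact: (Slin t%:C%C y z).
have xSR s : S s -> complex.Re d <= p (x - s).
  by move=> /xS; rewrite (complex_ge0E d0) pE lecR.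
have [f [fl fle fS fx]] := sublinear_separation sp p0 SsubR xSR.
have gl := complexify_linear fl; set g := complexify f in gl.
pose lg : {scalar E} := HB.pack g (GRing.isLinear.Build _ _ _ _ g gl).
have gZ k y : g (k *: y) = k * g y := linearZ_LR lg k y.
have gnorm y : `|g y| <= `|y|.
  have [->|gy0] := eqVneq (g y) 0; first by rewrite normr0.
  (* [u] has modulus one and [g (u *: y)] is the nonnegative real [`|g y|]. *)
  pose u := `|g y| / g y.
  have u1 : `|u| = 1 by rewrite normrM normr_id normfV divff// normr_eq0.
  have guy : g (u *: y) = `|g y| by rewrite gZ divfK.
  rewrite (complex_ge0E (normr_ge0 (g y))) -guy.
  by rewrite -[`|y|]mul1r -u1 -normrZ pE lecR; exact: fle.
have gdual : (g : E -> R[i]^o) \in @continuous_linear R[i] E.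
  by apply: (@bounded_dual_funP _ _ _ 1) => // y; rewrite mul1r.
exists (Dual gdual); split=> //= [s Ss|].
  have SiS : S ('i%C *: s).
    have := Slin 'i%C s 0; rewrite addr0 !inE; apply=> //.
    by rewrite inE in S0.
  by rewrite /g /complexify (fS _ Ss) (fS _ SiS) oppr0.
apply: le_trans (normc_ge_Re (g x)); rewrite (complex_ge0E d0) lecR /=.
by apply: le_trans fx _; exact: ler_norm.
Qed.

(** * The canonical image in the bidual *)

Section CanonicalImage.
Variables (K : supNumFieldType) (sepK : norm_separation K).

Lemma norm_canon (E : normedModType K) (x : E) : `|canon x| = `|x|.
Proof.
apply/le_anti/andP; split.
  apply: (@dual_norm_le _ _ (canon x)) => f f1 /=.
  by apply: le_trans (ler_dual_norm f x) _; rewrite ler_piMl.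
have S0 : submod_closed [in [set (0 : E)]].
  split=> [|k y z]; rewrite !inE //= => -> ->.
  by rewrite scaler0 addr0.
have [|f [_ f1 fx]] := @sepK E _ x _ S0 (normr_ge0 x).
  by move=> _ ->; rewrite subr0.
apply: le_trans fx _; rewrite -[f x]/(canon x f).
apply: le_trans (ler_dual_norm _ _) _; rewrite ler_piMr ?dual_norm_ge0//.
by apply: (@dual_norm_le _ _ f) => y; exact/le_trans/f1.
Qed.

Lemma canon_image_submod (E : normedModType K) :
  submod_closed [in canon_image E].
Proof.
split=> [|k F G]; rewrite !inE; first by exists 0 => //; exact: linear0.
by move=> [x _ <-] [y _ <-]; exists (k *: x + y) => //; exact: linearP.
Qed.

Variable E : completeNormedModType K.

(** The points [x] such that [canon x] is close to [G] form a Cauchy filter,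
    [canon] being isometric; its limit is mapped to [G]. *)
Lemma canon_image_closed (G : dual (dual E)) :
  (forall e, 0 < e -> exists x : E, `|G - canon x| < e) -> canon_image E G.
Proof.
move=> Gapprox.
pose F : set_system E :=
  filter_from [set e : K | 0 < e] (fun e => [set x | `|G - canon x| < e]).
have FF : ProperFilter F.
  apply: filter_from_proper; last by move=> e /= /Gapprox.
  apply: filter_from_filter; first by exists 1; exact: ltr01.
  move=> d e /= d0 e0.
  have [de|/ltW ed] := real_leP (gtr0_real d0) (gtr0_real e0).
    by exists d => // x /= Gx; split=> //; exact: lt_le_trans Gx de.
  by exists e => // x /= Gx; split=> //; exact: lt_le_trans Gx ed.
have : cauchy F.
  apply: cauchy_exP => e e0.
  have e20 : 0 < e / 2 by rewrite divr_gt0.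
  have [x Gx] := Gapprox _ e20; exists x, (e / 2) => // y /= Gy.
  rewrite -ball_normE /= -norm_canon linearB /= (splitr e).
  apply: le_lt_trans (ler_distD G _ _) (ltrD _ Gy).
  by rewrite distrC.
move=> /cauchy_cvg/cvg_ex[x Fx]; exists x => //.
apply/esym/eqP; rewrite -subr_eq0 -normr_le0; apply/ler_addgt0Pr => e e0.
rewrite add0r.
have e20 : 0 < e / 2 by rewrite divr_gt0.
have FG : F [set y | `|G - canon y| < e / 2] by exists (e / 2).
have Fb : F (ball x (e / 2)) by apply: Fx; exact: nbhsx_ballx.
have [y [/= Gy]] := filter_ex (filterI FG Fb).
rewrite -ball_normE /= => xy.
rewrite (splitr e); apply: le_trans (ler_distD (canon y) _ _) _.
rewrite lerD ?(ltW Gy)//.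
by rewrite -linearB norm_canon distrC ltW.
Qed.

(** If [T G] were at positive distance from the canonical image, a functional
    [Phi] would vanish on that image but not at [T G]; yet [Phi \o T] is weak*
    continuous and vanishes on a weak*-dense set. *)
Lemma weak_star_weak_range (T : dual (dual E) -> dual (dual E)) :
  continuous (T : weak_star (dual E) -> weak (dual (dual E))) ->
  (forall x, canon_image E (T (canon x))) ->
  forall G, canon_image E (T G).
Proof.
move=> Tc Tcanon G; apply: canon_image_closed => d d0; apply: contrapT => dT.
have [|Phi [Phi0 _ PhiG]] :=
    @sepK _ _ (T G) _ (@canon_image_submod E) (ltW d0).
  move=> _ [x _ <-]; rewrite real_leNgt ?normr_real ?gtr0_real//.
  by apply/negP => TGx; apply: dT; exists x.
have PhiT : continuous ((fun H => Phi (T H)) : weak_star (dual E) -> K^o).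
  move=> H; apply: (@continuous_comp _ _ _ (T : weak_star _ -> weak _) Phi).
    exact: Tc.
  exact: weak_functional_continuous.
have := weak_star_continuous_eq0 PhiT (fun x => Phi0 _ (Tcanon x)) G.
by move=> PhiG0; move: PhiG; rewrite PhiG0 normr0 (lt_geF d0).
Qed.

End CanonicalImage.

(** * Ideals in the bidual *)

Section Ideals.
Variables (K : supNumFieldType) (sepK : norm_separation K) (A : banachAlgType K).

Lemma arens_canon (a b : A) : arens (canon a) (canon b) = canon (bmul a b).
Proof. by apply: dualP. Qed.

Lemma Z1l_right_ideal : canon_image A `<=` Z1l A -> right_ideal (canon_image A).
Proof.
move=> AZ; split=> [|F G [a _ <-]]; first exact: canon_image_submod.
apply: (weak_star_weak_range sepK (T := arens (canon a))).
  by apply: AZ; exists a.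
by move=> b; rewrite arens_canon; exists (bmul a b).
Qed.

Lemma Z1r_left_ideal : canon_image A `<=` Z1r A -> left_ideal (canon_image A).
Proof.
move=> AZ; split=> [|F G [a _ <-]]; first exact: canon_image_submod.
apply: (weak_star_weak_range sepK (T := fun F => arens F (canon a))).
  by apply: AZ; exists a.
by move=> b; rewrite arens_canon; exists (bmul b a).
Qed.

End Ideals.

Theorem mainTheorem2 (R : realType) :
  (forall A : banachAlgType R,
    [/\ Z1l A = canon_image A -> right_ideal (canon_image A),
        Z1r A = canon_image A -> left_ideal (canon_image A) &
        Z1l A = canon_image A /\ Z1r A = canon_image A ->
          ideal (canon_image A)]) /\
  (forall A : banachAlgType R[i],
    [/\ Z1l A = canon_image A -> right_ideal (canon_image A),
        Z1r A = canon_image A -> left_ideal (canon_image A) &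
        Z1l A = canon_image A /\ Z1r A = canon_image A ->
          ideal (canon_image A)]).
Proof.
have ideals (K : supNumFieldType) (A : banachAlgType K) : norm_separation K ->
    [/\ Z1l A = canon_image A -> right_ideal (canon_image A),
        Z1r A = canon_image A -> left_ideal (canon_image A) &
        Z1l A = canon_image A /\ Z1r A = canon_image A ->
          ideal (canon_image A)].
  move=> sepK.
  have rI : Z1l A = canon_image A -> right_ideal (canon_image A).
    by move=> ZA; apply: Z1l_right_ideal => //; rewrite ZA.
  have lI : Z1r A = canon_image A -> left_ideal (canon_image A).
    by move=> ZA; apply: Z1r_left_ideal => //; rewrite ZA.
  by split=> // -[/rI rA /lI lA].
split=> A; apply: ideals.
  exact: real_norm_separation.
exact: complex_norm_separation.
Qed.
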